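(* Let $X$ be a subshift. If there exists an integer $n \geq 2$ for which $|F_X(n)| \leq 2$, then $X$ is sofic.
   Context: Let $A$ be a finite set (the alphabet). A subshift on $A$ is a shift-invariant subset $X$ of $A^{\mathbb{Z}}$ that is closed in the product topology. The language $L(X)$ is the set of all finite words which appear in points of $X$, and $L_n(X) = L(X)\cap A^n$. For $w \in L(X)$, the follower set $F_X(w)$ is the set of all right-infinite sequences $s \in A^{\mathbb{N}}$ such that the infinite word $ws$ occurs in some point of $X$. For a positive integer $n$, $F_X(n) = \{F_X(w) : w \in L_n(X)\}$ (a set of sets), so $|F_X(n)|$ is the number of distinct follower sets of words of length $n$ in $X$. A subshift is sofic if it is the image of a shift of finite type under a continuous shift-commuting map; equivalently, if $\{F_X(w) : w \in L(X)\}$ is finite. *)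

(* Defs.v *)
From HB Require Import structures.
From mathcomp Require Import all_boot all_order all_algebra.
From mathcomp Require Import all_classical topology function_spaces.

Set Implicit Arguments.
Unset Strict Implicit.
Unset Printing Implicit Defensive.

Import GRing.Theory.

Local Open Scope classical_set_scope.
Local Open Scope ring_scope.

(* A^Z with the product of the discrete topologies; its elements coerce to
   functions [int -> A]. *)
Definition full_shift (A : finType) : Type :=
  prod_topology (fun _ : int => discrete_topology A).

HB.instance Definition _ (A : finType) := Topological.copy (full_shift A)
  (prod_topology (fun _ : int => discrete_topology A)).

Definition shift {A : finType} (x : full_shift A) : full_shift A :=
  fun i : int => x (i + 1).

(* Shift-invariance of a two-sided subshift is [shift X = X], not just
   [shift X `<=` X]. *)
Definition subshift {A : finType} (X : set (full_shift A)) : Prop :=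
  closed X /\ shift @` X = X.

Definition occurs_at {A : finType} (w : seq A) (x : full_shift A) (i : int) :
    Prop :=
  mkseq (fun k => x (i + k%:Z)) (size w) = w.

Definition language {A : finType} (X : set (full_shift A)) : set (seq A) :=
  [set w | exists2 x, X x & exists i, occurs_at w x i].

Definition language_n {A : finType} (X : set (full_shift A)) (n : nat) :
    set (seq A) :=
  language X `&` [set w | size w = n].

Definition follower_set {A : finType} (X : set (full_shift A)) (w : seq A) :
    set (nat -> A) :=
  [set s | exists2 x, X x &
     exists i, occurs_at w x i /\
       forall k : nat, x (i + (size w)%:Z + k%:Z) = s k].

Definition follower_sets {A : finType} (X : set (full_shift A)) (n : nat) :
    set (set (nat -> A)) :=
  follower_set X @` language_n X n.

Definition shift_of_finite_type {A : finType} (X : set (full_shift A)) : Prop :=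
  exists F : seq (seq A),
    X = [set x | forall w, w \in F -> forall i, ~ occurs_at w x i].

(* The factor map is a total function on the ambient full shift, of which only
   the restriction to [Y] matters. *)
Definition sofic {A : finType} (X : set (full_shift A)) : Prop :=
  exists (B : finType) (Y : set (full_shift B))
         (f : full_shift B -> full_shift A),
    [/\ shift_of_finite_type Y,
        {within Y, continuous f},
        (forall y, Y y -> f (shift y) = shift (f y)) &
        f @` Y = X].

(* Main.v *)
(* Let U = F([::]) be the set of all right rays of X; each F(v) is the union of
   the F(bv), and F(wa) depends only on F(w) and a.  Suppose F(n) = {S, T} with
   n >= 2 and T = F(wa) not in F(n-1).  Then every word v of length at most n-1
   has S `<=` F(v), so F(a) contains S and T and equals U; likewise some v of
   length n-1 has F(v) = U, whence F(va) = F(a) = U is S or T.  Both are absurd: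
   U = T puts T in F(n-1), and U = S gives F(w) = U, so T = F(a) = U.
   Hence F(n) `<=` F(n-1), and then F(k) `<=` F(n-1) for all k >= n-1.  So X is
   presented by the graph whose vertices are the words of length n-1, taken up
   to their follower sets.  The vertex visited at time i by a point x of X is
   the eventual value of F(x_[i-k,i)) as k grows, so no compactness is needed. *)
Require Import Defs.
From mathcomp Require Import all_boot all_order all_algebra.
From mathcomp Require Import all_classical topology function_spaces.
From mathcomp Require Import zify.

Set Implicit Arguments.
Unset Strict Implicit.
Unset Printing Implicit Defensive.

Local Open Scope classical_set_scope.

(** * Coordinatewise convergence and continuity in the full shift *)

Lemma cvg_full_shift (A : finType) (F : set_system (full_shift A))
    (z : full_shift A) : Filter F ->
  (forall i, F [set x | x i = z i]) -> F --> z.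
Proof.
move=> FF Fz; apply/cvg_sup => i U [V] [[W oW <-] Wz] WU.
by apply: (filterS WU); apply: filterS (Fz i) => x /= xz; rewrite /= xz.
Qed.

Lemma nbhs_coord (A : finType) (z : full_shift A) i :
  nbhs z [set x : full_shift A | x i = z i].
Proof.
have := @proj_continuous int (fun=> discrete_topology A) i z [set a | a = z i].
by apply; rewrite nbhs_principalE; apply/principal_filterP.
Qed.

Lemma letter_map_continuous (A B : finType) (g : B -> A) :
  continuous ((fun y i => g (y i)) : full_shift B -> full_shift A).
Proof.
move=> y; apply: cvg_full_shift => [|i]; first exact: (@fmap_filter _ _ _ (nbhs y)). 
by apply: filterS (nbhs_coord y i) => x /= ->.
Qed.

(** * Follower sets as sets of right rays *)

Section FollowerSets.
Variables (A : finType) (X : set (full_shift A)).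
Implicit Types (u v w : seq A) (s : nat -> A).

Definition scons (a : A) s k := if k is k'.+1 then s k' else a.

Notation prepend w s := (foldr scons s w).

Definition ray s := exists2 x, X x & exists i : int, forall k, x (i + k%:Z)%R = s k.

Lemma occurs_at_prepend w s (x : full_shift A) i :
  (occurs_at w x i /\ forall k, x (i + (size w)%:Z + k%:Z)%R = s k) <->
  forall k, x (i + k%:Z)%R = prepend w s k.
Proof.
elim: w i => [|a w IH] i /=.
  rewrite /occurs_at; split=> [[_ xs] k|xs]; first by rewrite -xs GRing.addr0.
  by split=> // k; rewrite GRing.addr0.
have e k : (i + k.+1%:Z = i + 1 + k%:Z)%R by lia.
have mkE : occurs_at (a :: w) x i <-> x i = a /\ occurs_at w x (i + 1)%R.
  rewrite /occurs_at /mkseq /= GRing.addr0 -(addn0 1) iotaDl -map_comp.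
  rewrite (eq_map (g := fun k : nat => x (i + 1 + k%:Z)%R)); last by move=> k /=; rewrite -e.
  by split=> [[-> ->]|[-> ->]].
split=> [[/mkE [xa xw] xs] [|k]|H].
- by rewrite GRing.addr0.
- rewrite e /=; move: k; apply/IH; split=> // k.
  by rewrite -xs e.
have /IH [xw xs] : forall k, x (i + 1 + k%:Z)%R = prepend w s k.
  by move=> k; rewrite -e H.
split; first by apply/mkE; split=> //; have := H 0; rewrite GRing.addr0.
by move=> k; rewrite e xs.
Qed.

(** Merging word and tail into one sequence reduces concatenation of words to [foldr_cat]. *)
Lemma follower_setE w : follower_set X w = [set s | ray (prepend w s)].
Proof.
apply/seteqP; split=> s [x Xx [i H]]; exists x => //; exists i;
  exact/occurs_at_prepend.
Qed.

Lemma languageE w : language X w <-> follower_set X w !=set0.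
Proof.
split=> [[x Xx [i xw]]|[s [x Xx [i [xw _]]]]]; last by exists x => //; exists i.
by exists (fun k => x (i + (size w)%:Z + k%:Z)%R); exists x => //; exists i.
Qed.

Lemma follower_setsP n D : follower_sets X n D <->
  D !=set0 /\ exists2 w, size w = n & follower_set X w = D.
Proof.
split=> [[w [/languageE Lw wn] <-]|[D0 [w wn wD]]]; first by split=> //; exists w.
by exists w => //; split=> //; apply/languageE; rewrite wD.
Qed.

Lemma follower_set_cat u v :
  follower_set X (u ++ v) = [set s | follower_set X u (prepend v s)].
Proof. by rewrite !follower_setE; apply/seteqP; split=> s /=; rewrite foldr_cat. Qed.

Lemma follower_set_catr u v w :
  follower_set X u = follower_set X v ->
  follower_set X (u ++ w) = follower_set X (v ++ w).
Proof. by move=> uv; rewrite !follower_set_cat uv. Qed.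

Lemma follower_set_suffix u v : follower_set X (u ++ v) `<=` follower_set X v.
Proof.
rewrite !follower_setE => s [x Xx [i xs]]; exists x => //; exists (i + (size u)%:Z)%R.
move=> k; move: (xs (size u + k)); rewrite foldr_cat PoszD GRing.addrA => ->.
by elim: u {xs} => //= a u ->.
Qed.

(** The letters of [u] are read to the left of [v] in a point of [X]. Together with
    [follower_set_suffix] this makes [F(v)] the union of the [F(uv)] with [u] of length [n]. *)
Lemma follower_set_extend_left n v s : follower_set X v s ->
  exists2 u, size u = n & follower_set X (u ++ v) s.
Proof.
elim: n => [|n IH] in v * => vs; first by exists [::].
have [x Xx [i xs]] : ray (prepend v s) by move: vs; rewrite follower_setE.
have [|u un us] := IH (x (i - 1)%R :: v).
  rewrite follower_setE; exists x => //; exists (i - 1)%R => -[|k] /=.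
    by rewrite GRing.addr0.
  by rewrite -xs; congr (x _); lia.
by exists (rcons u (x (i - 1)%R)); rewrite ?size_rcons ?un // cat_rcons.
Qed.

(** * Inclusions between the families of follower sets of different lengths *)

Lemma follower_sets_stable m : follower_sets X m.+1 `<=` follower_sets X m ->
  forall k, (m <= k)%N -> follower_sets X k `<=` follower_sets X m.
Proof.
move=> sub; elim=> [|k IH]; first by rewrite leqn0 => /eqP ->.
rewrite leq_eqVlt => /predU1P[->//|mk] D /follower_setsP [D0 [w]].
case/lastP: w => // w a; rewrite size_rcons => -[wk] waD.
(* By induction some [v] of length [m] has the follower set of [w]; then [rcons v a] has length
   [m.+1], where [sub] applies. *)
have [|_ [v vm vw]] := (follower_setsP m (follower_set X w)).1.
  apply: (IH mk); apply/follower_setsP; split; last by exists w.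
  case: D0 => s; rewrite -waD -cats1 follower_set_cat => ws.
  by exists (scons a s).
apply: sub; apply/follower_setsP; split=> //; exists (rcons v a).
  by rewrite size_rcons vm.
by rewrite -waD -!cats1; exact: follower_set_catr.
Qed.

Lemma follower_sets_pred n :
  (follower_sets X n.+2 #<= `I_2)%card ->
  follower_sets X n.+2 `<=` follower_sets X n.+1.
Proof.
move/pcard_surjP => [g gsurj].
have two D E : follower_sets X n.+2 D -> follower_sets X n.+2 E -> D <> E ->
    forall w, size w = n.+2 -> follower_set X w !=set0 ->
    follower_set X w = D \/ follower_set X w = E.
  have {}gsurj B : follower_sets X n.+2 B -> B = g 0 \/ B = g 1.
    by move/gsurj => [[|[|//]] _ <-]; [left|right].
  move=> /gsurj D2 /gsurj E2 DE w wn w0.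
  have /gsurj : follower_sets X n.+2 (follower_set X w).
    by apply/follower_setsP; split=> //; exists w.
  by case: D2 E2 DE => -> [] -> // _ [] ->; auto.
move=> T XT; apply: contrapT => XnT.
have {XnT} neT w : size w = n.+1 -> follower_set X w <> T.
  move=> wn wT; apply: XnT; apply/follower_setsP; split; last by exists w.
  by case/follower_setsP: XT.
(* Otherwise [F(w)], the union of the [F(bw)], would be [T], against [neT]. *)
have TE w : size w = n.+1 -> follower_set X w !=set0 ->
    exists b, follower_set X (b :: w) !=set0 /\ follower_set X (b :: w) <> T.
  move=> wn w0; apply: contrapT => none; apply: (neT w wn).
  have bT b : follower_set X (b :: w) !=set0 -> follower_set X (b :: w) = T.
    by move=> b0; apply: contrapT => bT; apply: none; exists b.
  case: w0 => s0 ws0.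
  have lext s : follower_set X w s -> exists b, follower_set X (b :: w) s.
    by move/(follower_set_extend_left 1) => [[|b []] // _ ?]; exists b.
  apply/seteqP; split=> s.
    by move/lext => [b bs]; rewrite -(bT b) //; exists s.
  have [b bs0] := lext _ ws0.
  rewrite -(bT b); last by exists s0.
  exact: (@follower_set_suffix [:: b]).
have [T0 [wa wan waT]] := (follower_setsP _ _).1 XT.
case/lastP: wa => // w a in wan waT *.
have wn : size w = n.+1 by move: wan; rewrite size_rcons => -[].
have w0 : follower_set X w !=set0.
  case: T0 => s; rewrite -waT -cats1 follower_set_cat => ws.
  by exists (scons a s).
have [b0 [bw0 bwT]] := TE w wn w0.
set S := follower_set X (b0 :: w) in bw0 bwT.
have XS : follower_sets X n.+2 S.
  by apply/follower_setsP; split=> //; exists (b0 :: w) => //=; rewrite wn.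
have ST := two _ _ XS XT bwT.
(* Extend [v] leftwards to length [n.+1], then by a letter from [TE]: the follower set obtained is
   not [T], hence is [S]. *)
have Ssub v : (size v <= n.+1)%N -> follower_set X v !=set0 -> S `<=` follower_set X v.
  move=> vn [s /(follower_set_extend_left (n.+1 - size v)) [u un us]].
  have uvn : size (u ++ v) = n.+1 by rewrite size_cat un subnK.
  have [|b [bu0 buT]] := TE _ uvn; first by exists s.
  have [|<-|//] := ST (b :: u ++ v) _ bu0; first by rewrite /= uvn.
  by rewrite -cat_cons; exact: follower_set_suffix.
pose U := follower_set X [::].
have leU v : follower_set X v `<=` U.
  by rewrite -(cats0 v); exact: follower_set_suffix.
(* Every ray in [U] follows a word of length [n.+2], whose follower set is [S] or [T]. *)
have eqU v : S `<=` follower_set X v -> T `<=` follower_set X v ->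
    follower_set X v = U.
  move=> Sv Tv; apply/seteqP; split; first exact: leU.
  move=> s /(follower_set_extend_left n.+2) [u un]; rewrite cats0 => us.
  by have [|uS|uT] := ST u un; [exists s|apply: Sv; rewrite -uS|apply: Tv; rewrite -uT].
(* [Ssub] covers the one-letter word because [n.+1] is at least 1; this is where a length of at
   least 2 matters. *)
have aU : follower_set X [:: a] = U.
  apply: eqU; last by rewrite -waT -cats1; exact: follower_set_suffix.
  apply: Ssub => //; case: T0 => s; rewrite -waT -cats1 => /follower_set_suffix.
  by exists s.
(* The witness is [rcons w a] without its first letter. *)
have [v vn vU] : exists2 v, size v = n.+1 & follower_set X v = U.
  case E : (rcons w a) wan waT => [//|c v] [vn] cvT.
  have Tv : T `<=` follower_set X v.
    by rewrite -cvT; exact: (@follower_set_suffix [:: c]).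
  exists v => //; apply: eqU => //; apply: Ssub; first by rewrite vn.
  by case: T0 => s Ts; exists s; exact: Tv.
have UT : U <> T by rewrite -vU; exact: neT.
have vaU : follower_set X (rcons v a) = U.
  by rewrite -aU -cats1 (@follower_set_catr v [::]).
have US : U = S.
  have [||//|] := ST (rcons v a); rewrite ?size_rcons ?vn ?vaU //.
  by case: T0 => s; rewrite -waT => /leU Us; exists s.
have wU : follower_set X w = U.
  by apply/seteqP; split; [exact: leU|rewrite US; apply: Ssub; rewrite ?wn].
(* Since [F(w) = U = F(v)], appending [a] gives [T = F(wa) = F(va) = U]. *)
apply: UT; rewrite -waT -vaU -!cats1; apply: follower_set_catr.
by rewrite vU.
Qed.

(** * Translations, membership tested on windows, and shifts given by a relation *)

Hypothesis subX : subshift X.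

Lemma subshift_translate (x : full_shift A) (j : int) :
  X x -> X (fun i => x (i + j)%R).
Proof.
have [_ sX] := subX.
have fwd y : X y -> X (fun i => y (i + 1)%R).
  by move=> Xy; rewrite -sX; exists y.
have bwd y : X y -> X (fun i => y (i - 1)%R).
  rewrite -{1}sX => -[z Xz <-]; rewrite (_ : (fun=> _) = z) //.
  by apply/funext => i; rewrite /shift GRing.subrK.
move=> Xx; case: j => k.
  elim: k => [|k IH].
    by rewrite (_ : (fun=> _) = x) //; apply/funext => i; rewrite GRing.addr0.
  rewrite (_ : (fun=> _) = fun i => x (i + 1 + k%:Z)%R); first exact: (fwd _ IH).
  by apply/funext => i; congr (x _); lia.
(* [Negz k] is [-(k+1)], so the base case is already one backward shift. *)
elim: k => [|k IH]; first exact: (bwd _ Xx).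
rewrite (_ : (fun=> _) = fun i => x (i - 1 + Negz k)%R); first exact: (bwd _ IH).
by apply/funext => i; congr (x _); lia.
Qed.

Definition window (x : full_shift A) (i : int) n := mkseq (fun k => x (i + k%:Z)%R) n.

Lemma window_rcons x i n : window x i n.+1 = rcons (window x i n) (x (i + n%:Z)%R).
Proof. exact: mkseqS. Qed.

Lemma window_cons x i n : window x i n.+1 = x i :: window x (i + 1)%R n.
Proof.
rewrite /window /mkseq /= GRing.addr0 -(addn0 1) iotaDl -map_comp.
by congr (_ :: _); apply: eq_map => k /=; congr (x _); lia.
Qed.

(** Points of [X] that agree with [z] on growing central windows converge to [z], and [X] is
    closed. *)
Lemma subshift_window (z : full_shift A) :
  (forall i n, language X (window z i n)) -> X z.
Proof.
move=> Lz.
have /choice [u uP] : forall n : nat, exists x : full_shift A,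
    X x /\ forall i : int, (`|i| < n)%N -> x i = z i.
  move=> n.
  have [x Xx [j]] := Lz (- n%:Z)%R (n + n).
  rewrite /occurs_at size_mkseq => xz.
  (* The window of [z] starting at [-n] occurs in [x] at [j]; this translation moves it back to
     [-n]. *)
  exists (fun i => x (i + (j + n%:Z))%R); split; first exact: subshift_translate.
  move=> i ni.
  have [k kn ->] : exists2 k, (k < n + n)%N & i = (- n%:Z + k%:Z)%R.
    by exists (absz (i + n%:Z)%R); lia.
  have := congr1 (fun w => nth (z i) w k) xz.
  by rewrite !nth_mkseq // => <-; congr (x _); lia.
apply: (@closed_cvg _ _ \oo _ u X subX.1).
  by apply: nearW => n; exact: (uP n).1.
apply: cvg_full_shift => i.
by exists `|i|.+1 => // n /= ni; exact: (uP n).2.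
Qed.

Lemma shift_of_finite_type_rel (B : finType) (r : rel B) :
  shift_of_finite_type [set y : full_shift B | forall i, r (y i) (y (i + 1)%R)].
Proof.
exists [seq [:: p.1; p.2] | p <- enum [the finType of (B * B)%type] & ~~ r p.1 p.2].
apply/seteqP; split=> y /= yr.
  move=> w /mapP [[a b]]; rewrite mem_filter => /andP[/= /negP rab _] -> i.
  by rewrite /occurs_at /mkseq /= GRing.addr0 => -[ya yb]; apply: rab; rewrite -ya -yb.
move=> i; apply: contrapT => /negP ri.
apply: (yr [:: y i; y (i + 1)%R] _ i); last by rewrite /occurs_at /mkseq /= GRing.addr0.
by apply/mapP; exists (y i, y (i + 1)%R) => //; rewrite mem_filter /= ri mem_enum.
Qed.

(** * The presentation by a finite graph *)

Section Stable.
Variable m : nat.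
Hypothesis stable : follower_sets X m.+1 `<=` follower_sets X m.

(* As k grows the follower sets of x_[i-k,i) decrease within a finite family. *)
Lemma past_follower_set (x : full_shift A) (i : int) : X x ->
  exists t : m.-tuple A, exists K, forall k, (K <= k)%N ->
    follower_set X (window x (i - k%:Z)%R k) = follower_set X t.
Proof.
move=> Xx.
pose G k := follower_set X (window x (i - k%:Z)%R k).
have Gdec k d : G (k + d) `<=` G k.
  elim: d => [|d IH]; first by rewrite addn0.
  apply: subset_trans IH; rewrite addnS /G window_cons.
  rewrite (_ : (_ + 1)%R = i - (k + d)%N%:Z)%R; last by lia.
  exact: (@follower_set_suffix [:: _]).
have G0 k : G k !=set0.
  apply/languageE; exists x => //; exists (i - k%:Z)%R.
  by rewrite /occurs_at size_mkseq.
have Gt k : (m <= k)%N -> exists t : m.-tuple A, G k = follower_set X t.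
  move=> mk; have [|_ [w /eqP wm <-]] := (follower_setsP m (G k)).1.
    apply: (follower_sets_stable stable mk); apply/follower_setsP; split=> //.
    by exists (window x (i - k%:Z)%R k); rewrite ?size_mkseq.
  by exists (Tuple wm).
(* Choose [K] minimising the cardinality of [below]. From then on [below] is constant, so the word
   [t] with [G K = F(t)] stays in it, giving [G K] inside [G k]. *)
pose below k := finset (fun t : m.-tuple A => `[< follower_set X t `<=` G k >]).
have ex : exists j, `[< exists2 k, (m <= k)%N & #|below k| = j >].
  by exists #|below m|; apply/asboolP; exists m.
have [_ /asboolP [K mK <-] Kmin] := ex_minnP ex.
have [t Kt] := Gt K mK.
exists t, K => k Kk; rewrite -Kt; apply/seteqP; split.
  by rewrite -(subnKC Kk); exact: Gdec.
have sub : below k \subset below K.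
  apply/fintype.subsetP => u; rewrite !finset.in_set => /asboolP ut; apply/asboolP.
  by apply: (subset_trans ut); rewrite -(subnKC Kk); exact: Gdec.
have : below k == below K.
  rewrite eqEcard sub; apply: Kmin; apply/asboolP; exists k => //.
  exact: leq_trans Kk.
move/eqP/setP/(_ t); rewrite !finset.in_set.
have -> : `[< follower_set X t `<=` G K >] by apply/asboolP; rewrite Kt.
by move/asboolP; rewrite -Kt.
Qed.

Lemma sofic_of_stable : sofic X.
Proof.
(* A symbol [(t, a)] is the edge labelled [a] leaving the vertex [t]; its end is fixed only up to
   follower set. Nonempty follower sets exclude edges whose label cannot be read in [X]. *)
pose B := (m.-tuple A * A)%type : finType.
pose r (b c : B) := `[< follower_set X (rcons b.1 b.2) = follower_set X c.1 /\
                        follower_set X c.1 !=set0 >].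
exists B, [set y : full_shift B | forall i, r (y i) (y (i + 1)%R)],
  (fun y i => (y i).2); split=> //.
- exact: shift_of_finite_type_rel.
- by apply: continuous_subspaceT; exact: (@letter_map_continuous A B snd).
apply/seteqP; split=> [_ [y yr <-]|x Xx].
  apply: subshift_window => i n; apply/languageE.
  have path_follower k : follower_set X ((y i).1 ++ window (fun j => (y j).2) i k) =
      follower_set X (y (i + k%:Z)%R).1.
    elim: k => [|k IH]; first by rewrite cats0 GRing.addr0.
    rewrite window_rcons -rcons_cat -cats1 (follower_set_catr _ IH) cats1.
    have /asboolP [-> _] := yr (i + k%:Z)%R.
    by congr (follower_set X (y _).1); lia.
  (* The edge entering position [i + n] shows that the follower set there is nonempty, also for
     [n = 0]. *)
  have /asboolP [_ [s]] := yr (i + n%:Z - 1)%R.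
  rewrite GRing.subrK -path_follower => /follower_set_suffix ws.
  by exists s.
have [q qP] := choice (fun i => past_follower_set i Xx).
exists (fun i => (q i, x i)) => // i; apply/asboolP => /=.
have [K KP] := qP i; have [L LP] := qP (i + 1)%R.
(* The windows of length [k] ending at [i] and of length [k.+1] ending at [i + 1] both start at
   [i - k], so the second is the first followed by [x i]. *)
set k := maxn K L.
have Kk := KP k (leq_maxl _ _); have Lk := LP k.+1 (leqW (leq_maxr _ _)).
split; rewrite -Lk.
  rewrite -cats1 -(follower_set_catr _ Kk) cats1 window_rcons.
  by congr (follower_set X (rcons (window x _ _) (x _))); lia.
apply/languageE; exists x => //; eexists; rewrite /occurs_at size_mkseq; reflexivity.
Qed.

End Stable.
End FollowerSets.

Theorem theorem4p9 (A : finType) (X : set (full_shift A)) (n : nat) :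
  subshift X -> (2 <= n)%N -> (follower_sets X n #<= `I_2)%card ->
  sofic X.
Proof.
case: n => [|[|n]] // subX _ /follower_sets_pred; exact: sofic_of_stable.
Qed.
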